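(* Let $T=T(\mathbf u,\mathbf v)\in\mathcal T$ be $n\times n$, let $\mathbf u_k,\mathbf v_k$ ($k=1,\dots,n$) and $\theta_k$ ($k=1,\dots,n-1$) be the exact vectors and angles of the downdating recursion for $T$ started from $\mathbf u_1=\mathbf u$, $\mathbf v_1=\mathbf v$, and let $\tilde{\mathbf u}_k,\tilde{\mathbf v}_k$ ($k=1,\dots,n$) be computed vectors, depending on the machine precision $\epsilon$, with $\tilde{\mathbf u}_k=\mathbf u_k+O(\epsilon)$ and $\tilde{\mathbf v}_k=\mathbf v_k+O(\epsilon)$. Assume that there are matrices $G_k\in\mathbb R^{n\times n}$ with $$\tilde{\mathbf u}_{k+1}\tilde{\mathbf u}_{k+1}^T-\tilde{\mathbf v}_{k+1}\tilde{\mathbf v}_{k+1}^T=Z\tilde{\mathbf u}_k\tilde{\mathbf u}_k^TZ^T-\tilde{\mathbf v}_k\tilde{\mathbf v}_k^T+\epsilon G_k+O(\epsilon^2),\qquad k=1,\dots,n-1,$$ and a positive constant $c_h$ such that, for $k=1,\dots,n-1$ and $j=0,\dots,n-1$, $$\|Z_jG_kZ_j^T\|\le c_h\,\|H(\theta_k)\|\left(\|Z_{j+1}\mathbf u_k\|+\|Z_j\mathbf v_k\|\right)\left(\|Z_j\mathbf u_{k+1}\|+\|Z_j\mathbf v_{k+1}\|\right).$$ Let $\tilde U=\sum_{k=1}^n\mathbf e_k\tilde{\mathbf u}_k^T$. Then $$\|T-\tilde U^T\tilde U\|\le 2n\|\mathbf u\|\left(\|\tilde{\mathbf u}_1-\mathbf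 u\|+\|\tilde{\mathbf v}_1-\mathbf v\|\right)+8\epsilon c_h\sum_{j=1}^{n-1}(n-j)\,\mathrm{Tr}(Z_jTZ_j^T)+O(\epsilon^2).$$
   Context: All vectors lie in $\mathbb R^n$ and all matrices in $\mathbb R^{n\times n}$ unless indicated; $\|\cdot\|$ is the Euclidean norm of vectors and the induced operator norm of matrices; $\mathbf e_k$ is the $k$th standard unit vector. $Z=\sum_{i=1}^{n-1}\mathbf e_{i+1}\mathbf e_i^T$ is the shift-down matrix, $Z_0=I$ and $Z_k=Z^k$ for $k>0$. The hyperbolic rotation matrix is $$H(\theta)=\frac1{\cos\theta}\begin{pmatrix}1&-\sin\theta\\-\sin\theta&1\end{pmatrix}\in\mathbb R^{2\times2}.$$ The class $\mathcal T$ consists of the symmetric positive definite matrices $T$ for which there are vectors $\mathbf u,\mathbf v\in\mathbb R^n$ (called generators; one writes $T=T(\mathbf u,\mathbf v)$) with $T-ZTZ^T=\mathbf u\mathbf u^T-\mathbf v\mathbf v^T$ and $\mathbf v^T\mathbf e_1=0$. Exact downdating recursion: given $T=T(\mathbf u,\mathbf v)\in\mathcal T$, set $\mathbf u_1=\mathbf u$, $\mathbf v_1=\mathbf v$, and for $k=1,\dots,n-1$ set $\sin\theta_k=\mathbf e_{k+1}^T\mathbf v_k/\mathbf e_k^T\mathbf u_k$, $\cos\theta_k=\sqrt{1-\sin^2\theta_k}$, and $$\begin{pmatrix}\mathbf u_{k+1}^T\\ \mathbf v_{k+1}^T\end{pmatrix}=H(\theta_k)\begin{pmatrix}\mathbf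 u_k^TZ^T\\ \mathbf v_k^T\end{pmatrix}.$$ For $T\in\mathcal T$ one has $|\mathbf e_k^T\mathbf u_k|>|\mathbf e_{k+1}^T\mathbf v_k|$ for each $k=1,\dots,n-1$, so this is well defined. These vectors satisfy $\mathbf u_{k+1}\mathbf u_{k+1}^T-\mathbf v_{k+1}\mathbf v_{k+1}^T=Z\mathbf u_k\mathbf u_k^TZ^T-\mathbf v_k\mathbf v_k^T$, $\mathbf e_j^T\mathbf u_k=0$ for $j<k$, and $\mathbf e_j^T\mathbf v_k=0$ for $j\le k$. Asymptotic convention (first order analysis): the problem ($n$, $T$, $\mathbf u$, $\mathbf v$) is fixed and $\epsilon\to0+$. The computed vectors $\tilde{\mathbf u}_k,\tilde{\mathbf v}_k$ and the matrices $G_k$ may depend on $\epsilon$; $c_h$ does not depend on $\epsilon,j,k$. Constants in the $O$ terms may depend on the fixed problem (including $n$). In the perturbed downdating relation the term $O(\epsilon^2)$ is a matrix whose elements are bounded by a constant multiple of $\epsilon^2\|G_k\|$. *)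

(* Defs.v *)
From mathcomp Require Import all_boot all_order all_algebra.
From mathcomp Require Import all_classical all_reals all_analysis.

Set Implicit Arguments.
Unset Strict Implicit.
Unset Printing Implicit Defensive.

Import Order.TTheory GRing.Theory Num.Theory.
Import numFieldNormedType.Exports.

Local Open Scope classical_set_scope.
Local Open Scope ring_scope.

(* MathComp-Analysis norms matrices by the largest absolute entry, so the
   Euclidean norm and the operator norm it induces are defined here. *)
Definition enorm (R : realType) (n : nat) (x : 'cV[R]_n) : R :=
  Num.sqrt (\sum_(i < n) x i 0 ^+ 2).

Definition opnorm (R : realType) (m n : nat) (A : 'M[R]_(m, n)) : R :=
  sup [set enorm (A *m x) | x in [set x : 'cV[R]_n | enorm x <= 1]].

(* Indices are 1-based: [e_ R n k] has its 1 at the ordinal of value k.-1, and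
   is 0 unless 1 <= k <= n. *)
Definition e_ (R : realType) (n k : nat) : 'cV[R]_n :=
  \col_(i < n) (i.+1 == k)%:R.

Definition dotp (R : realType) (n : nat) (x y : 'cV[R]_n) : R :=
  (x^T *m y) 0 0.

Definition Zmx (R : realType) (n : nat) : 'M[R]_n :=
  \sum_(1 <= i < n) e_ R n i.+1 *m (e_ R n i)^T.

Definition Zpow (R : realType) (n j : nat) : 'M[R]_n := Zmx R n ^+ j.

Definition Hrot (R : realType) (t : R) : 'M[R]_(1 + 1) :=
  (cos t)^-1 *: \matrix_(i, j) (if i == j then 1 else - sin t).

Definition posdef (R : realType) (n : nat) (T : 'M[R]_n) : Prop :=
  T^T = T /\ forall x : 'cV[R]_n, x != 0 -> 0 < dotp x (T *m x).

Definition generators (R : realType) (n : nat) (T : 'M[R]_n)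
    (u v : 'cV[R]_n) : Prop :=
  T - Zmx R n *m T *m (Zmx R n)^T = u *m u^T - v *m v^T
  /\ dotp v (e_ R n 1) = 0.

Definition classT (R : realType) (n : nat) (T : 'M[R]_n) : Prop :=
  posdef T /\ exists u v : 'cV[R]_n, generators T u v.

(* Only the values u_ k, v_ k for 1 <= k <= n and theta k for 1 <= k < n are
   constrained.  The angle enters through its sine and cosine alone. *)
Definition downdating (R : realType) (n : nat) (u v : 'cV[R]_n)
    (u_ v_ : nat -> 'cV[R]_n) (theta : nat -> R) : Prop :=
  [/\ u_ 1 = u, v_ 1 = v &
   forall k : nat, (1 <= k < n)%N ->
     [/\ sin (theta k) = dotp (e_ R n k.+1) (v_ k) / dotp (e_ R n k) (u_ k),
         cos (theta k) = Num.sqrt (1 - sin (theta k) ^+ 2) &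
         col_mx (u_ k.+1)^T (v_ k.+1)^T =
           Hrot (theta k) *m col_mx ((u_ k)^T *m (Zmx R n)^T) (v_ k)^T]].

(* The O(eps^2) matrix in the perturbed recursion: each entry of the residual
   is O(eps^2 * opnorm (G eps k)) as eps -> 0+. *)
Definition perturbed_downdating (R : realType) (n : nat)
    (ut vt : R -> nat -> 'cV[R]_n) (G : R -> nat -> 'M[R]_n) : Prop :=
  forall k : nat, (1 <= k < n)%N -> forall a b : 'I_n,
    (fun eps : R =>
       (ut eps k.+1 *m (ut eps k.+1)^T - vt eps k.+1 *m (vt eps k.+1)^T
        - (Zmx R n *m ut eps k *m (ut eps k)^T *m (Zmx R n)^T
           - vt eps k *m (vt eps k)^T + eps *: G eps k)) a b)
    =O_ ((0 : R)^'+) (fun eps : R => eps ^+ 2 * opnorm (G eps k)).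

(* Main.v *)
(* Write [E] for [T - Ut^T Ut = T - sum_k ut_k ut_k^T] and [Z_j] for [Zpow R n j].
   Summing the perturbed recursion over [k] gives the displacement
     E - Z E Z^T = (u u^T - ut_1 ut_1^T) - (v v^T - vt_1 vt_1^T)
                   - eps * sum_k G_k + O(eps^2),
   because [Z u_n = 0] and [v_n = 0] make the boundary terms [vt_n vt_n^T] and
   [Z ut_n ut_n^T Z^T] second order. As [Z_n = 0], [E] is the sum over [j < n] of
   this matrix conjugated by [Z_j], and conjugation by [Z_j] does not increase
   the operator norm.

   It remains to bound the growth factors multiplying [c_h]. Since the rotations
   preserve [u u^T - v v^T], descending induction on [k] gives
   [|Z_j v_k| <= |Z_j u_k|] and [|Z_j v_k| <= |Z_{j+1} u_k|]. The relation
   [u_{k+1} = cos * Z u_k - sin * v_{k+1}] then yields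
   [|Z_j u_{k+1}| <= cos * (n - 1 - j) * |Z_{j+1} u_k|], which absorbs the factor
   [|H| <= 2 / cos], and [sum_k |Z_j u_k|^2 = Tr (Z_j T Z_j^T)]. *)
Require Import Defs.
From mathcomp Require Import all_boot all_order all_algebra.
From mathcomp Require Import all_classical all_reals all_analysis.
From mathcomp Require Import ring lra.

Set Implicit Arguments.
Unset Strict Implicit.
Unset Printing Implicit Defensive.

Import Order.TTheory GRing.Theory Num.Theory.
Import numFieldNormedType.Exports.
Local Open Scope classical_set_scope.
Local Open Scope ring_scope.

(** * Euclidean norm and induced operator norm *)

Lemma dotpE (R : realType) (n : nat) (x y : 'cV[R]_n) :
  dotp x y = \sum_(i < n) x i 0 * y i 0.
Proof. by rewrite /dotp mxE; apply: eq_bigr => i _; rewrite mxE. Qed.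

Lemma sqr_enorm (R : realType) (n : nat) (x : 'cV[R]_n) :
  enorm x ^+ 2 = dotp x x.
Proof.
rewrite sqr_sqrtr ?dotpE; last by apply: sumr_ge0 => i _; apply: sqr_ge0.
by apply: eq_bigr => i _; rewrite expr2.
Qed.

Lemma enorm_ge0 (R : realType) (n : nat) (x : 'cV[R]_n) : 0 <= enorm x.
Proof. exact: sqrtr_ge0. Qed.

Lemma enorm0 (R : realType) (n : nat) : enorm (0 : 'cV[R]_n) = 0.
Proof. by rewrite /enorm big1 ?sqrtr0// => i _; rewrite mxE expr0n. Qed.

Lemma le_coord_enorm (R : realType) (n : nat) (x : 'cV[R]_n) (i : 'I_n) :
  `|x i 0| <= enorm x.
Proof.
rewrite -(@ler_pXn2r _ 2)// ?nnegrE ?enorm_ge0// sqr_enorm dotpE real_normK ?num_real//.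
by rewrite (bigD1 i)//= expr2 lerDl sumr_ge0// => j _; rewrite -expr2 sqr_ge0.
Qed.

Lemma enorm_eq0 (R : realType) (n : nat) (x : 'cV[R]_n) : enorm x = 0 -> x = 0.
Proof.
move=> x0; apply/colP => i; apply/eqP; rewrite mxE -normr_le0 -x0.
exact: le_coord_enorm.
Qed.

Lemma enormZ (R : realType) (n : nat) (a : R) (x : 'cV[R]_n) :
  enorm (a *: x) = `|a| * enorm x.
Proof.
rewrite /enorm -sqrtr_sqr -sqrtrM ?sqr_ge0// mulr_sumr.
by congr Num.sqrt; apply: eq_bigr => i _; rewrite mxE exprMn.
Qed.

Lemma enormN (R : realType) (n : nat) (x : 'cV[R]_n) : enorm (- x) = enorm x.
Proof. by rewrite -scaleN1r enormZ normrN1 mul1r. Qed.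

(** Cauchy-Schwarz: with [a = enorm x] and [b = enorm y], the squared length of [b x - a y] is
    [2ab (ab - dotp x y)], and [ab] can be divided out once both norms are nonzero. *)
Lemma dotp_le_enorm (R : realType) (n : nat) (x y : 'cV[R]_n) :
  dotp x y <= enorm x * enorm y.
Proof.
set a := enorm x; set b := enorm y.
have [x0|x_neq0] := eqVneq a 0.
  by rewrite x0 mul0r (enorm_eq0 x0) dotpE big1// => i _; rewrite mxE mul0r.
have [y0|y_neq0] := eqVneq b 0.
  by rewrite y0 mulr0 (enorm_eq0 y0) dotpE big1// => i _; rewrite mxE mulr0.
have a0 : 0 < a by rewrite lt_def x_neq0 enorm_ge0.
have b0 : 0 < b by rewrite lt_def y_neq0 enorm_ge0.
have : 0 <= \sum_(i < n) (b * x i 0 - a * y i 0) ^+ 2.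
  by apply: sumr_ge0 => i _; apply: sqr_ge0.
have -> : \sum_(i < n) (b * x i 0 - a * y i 0) ^+ 2 =
    b ^+ 2 * dotp x x + a ^+ 2 * dotp y y - 2 * (a * b) * dotp x y.
  rewrite !dotpE !mulr_sumr -big_split/= -sumrB.
  by apply: eq_bigr => i _; ring.
rewrite -!sqr_enorm -/a -/b => h.
have {}h : 0 <= 2 * (a * b) * (a * b - dotp x y) by apply: le_trans h _; lra.
by move: h; rewrite pmulr_rge0 ?mulr_gt0// subr_ge0.
Qed.

Lemma enormD (R : realType) (n : nat) (x y : 'cV[R]_n) :
  enorm (x + y) <= enorm x + enorm y.
Proof.
rewrite -(@ler_pXn2r _ 2)// ?nnegrE ?addr_ge0 ?enorm_ge0// sqr_enorm.
have -> : dotp (x + y) (x + y) = dotp x x + dotp y y + 2 * dotp x y.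
  by rewrite !dotpE mulr_sumr -!big_split/=; apply: eq_bigr => i _; rewrite !mxE; ring.
rewrite -!sqr_enorm; have := dotp_le_enorm x y; lra.
Qed.

Lemma enorm_le_norm1 (R : realType) (n : nat) (x : 'cV[R]_n) :
  enorm x <= \sum_(i < n) `|x i 0|.
Proof.
have s0 : 0 <= \sum_(i < n) `|x i 0| by apply: sumr_ge0.
rewrite -(@ler_pXn2r _ 2)// ?nnegrE ?enorm_ge0// sqr_enorm dotpE.
rewrite [leRHS]expr2 mulr_suml ler_sum// => i _.
rewrite -expr2 -real_normK ?num_real// expr2 ler_wpM2l//.
by rewrite (bigD1 i)//= lerDl sumr_ge0.
Qed.

Lemma enorm_mulmx_le_entries (R : realType) (m n : nat) (A : 'M[R]_(m, n)) (x : 'cV[R]_n) :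
  enorm (A *m x) <= (\sum_(i < m) \sum_(j < n) `|A i j|) * enorm x.
Proof.
apply: le_trans (enorm_le_norm1 _) _.
rewrite mulr_suml ler_sum// => i _; rewrite mxE mulr_suml.
apply: le_trans (ler_norm_sum _ _ _) _; apply: ler_sum => j _.
by rewrite normrM ler_wpM2l// le_coord_enorm.
Qed.

(** Makes the [sup] in [opnorm] a genuine least upper bound instead of a default value: the sum of
    the absolute entries bounds the image of the unit ball. *)
Lemma opnorm_has_sup (R : realType) (m n : nat) (A : 'M[R]_(m, n)) :
  has_sup [set enorm (A *m x) | x in [set x : 'cV[R]_n | enorm x <= 1]].
Proof.
split; first by exists (enorm (A *m 0)), 0 => //=; rewrite enorm0.
exists (\sum_(i < m) \sum_(j < n) `|A i j|) => _ [x /= x1 <-].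
apply: le_trans (enorm_mulmx_le_entries _ _) _.
by apply: ler_piMr => //; apply: sumr_ge0 => i _; apply: sumr_ge0.
Qed.

Lemma opnorm_le (R : realType) (m n : nat) (A : 'M[R]_(m, n)) (b : R) :
  0 <= b -> (forall x, enorm (A *m x) <= b * enorm x) -> opnorm A <= b.
Proof.
move=> b0 Ab; apply: ge_sup; first by case: (opnorm_has_sup A).
move=> _ [x /= x1 <-]; apply: le_trans (Ab x) _.
exact: ler_piMr.
Qed.

Lemma opnorm_ge0 (R : realType) (m n : nat) (A : 'M[R]_(m, n)) : 0 <= opnorm A.
Proof.
apply: sup_upper_bound (opnorm_has_sup A) _ _.
by exists 0; rewrite /= ?mulmx0 enorm0.
Qed.

Lemma enorm_mulmx_le (R : realType) (m n : nat) (A : 'M[R]_(m, n)) (x : 'cV[R]_n) :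
  enorm (A *m x) <= opnorm A * enorm x.
Proof.
have [x0|x_neq0] := eqVneq (enorm x) 0.
  by rewrite (enorm_eq0 x0) mulmx0 !enorm0 mulr0.
have x0 : 0 < enorm x by rewrite lt_def x_neq0 enorm_ge0.
rewrite -ler_pdivrMr// mulrC -[(enorm x)^-1]ger0_norm ?invr_ge0 ?enorm_ge0//.
rewrite -enormZ scalemxAr; apply: sup_upper_bound (opnorm_has_sup A) _ _.
by exists ((enorm x)^-1 *: x) => //=; rewrite enormZ ger0_norm ?invr_ge0 ?enorm_ge0// mulVf.
Qed.

Lemma opnorm_le_entries (R : realType) (m n : nat) (A : 'M[R]_(m, n)) :
  opnorm A <= \sum_(i < m) \sum_(j < n) `|A i j|.
Proof.
apply: opnorm_le; first by apply: sumr_ge0 => i _; apply: sumr_ge0.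
exact: enorm_mulmx_le_entries.
Qed.

Lemma opnormD (R : realType) (m n : nat) (A B : 'M[R]_(m, n)) :
  opnorm (A + B) <= opnorm A + opnorm B.
Proof.
apply: opnorm_le => [|x]; first by rewrite addr_ge0 ?opnorm_ge0.
rewrite mulmxDl mulrDl; apply: le_trans (enormD _ _) _.
by rewrite lerD ?enorm_mulmx_le.
Qed.

Lemma opnorm0 (R : realType) (m n : nat) : opnorm (0 : 'M[R]_(m, n)) = 0.
Proof.
apply/eqP; rewrite eq_le opnorm_ge0 andbT; apply: opnorm_le => // x.
by rewrite mul0mx enorm0 mul0r.
Qed.

Lemma opnormZ_le (R : realType) (m n : nat) (a : R) (A : 'M[R]_(m, n)) :
  opnorm (a *: A) <= `|a| * opnorm A.
Proof.
apply: opnorm_le => [|x]; first by rewrite mulr_ge0 ?opnorm_ge0.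
by rewrite -scalemxAl enormZ -mulrA ler_wpM2l ?enorm_mulmx_le.
Qed.

Lemma opnormN (R : realType) (m n : nat) (A : 'M[R]_(m, n)) :
  opnorm (- A) = opnorm A.
Proof.
have le B : opnorm (- B) <= opnorm (B : 'M[R]_(m, n)).
  by rewrite -scaleN1r; apply: le_trans (opnormZ_le _ _) _; rewrite normrN1 mul1r.
by apply/eqP; rewrite eq_le le -{1}[A]opprK le.
Qed.

Lemma opnormB (R : realType) (m n : nat) (A B : 'M[R]_(m, n)) :
  opnorm (A - B) <= opnorm A + opnorm B.
Proof. by rewrite -(opnormN B) opnormD. Qed.

Lemma opnorm_sum (R : realType) (m n : nat) (I : Type) (r : seq I) (P : pred I)
    (F : I -> 'M[R]_(m, n)) :
  opnorm (\sum_(i <- r | P i) F i) <= \sum_(i <- r | P i) opnorm (F i).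
Proof.
elim/big_ind2 : _ => //; first by rewrite opnorm0.
by move=> x a y b xa yb; apply: le_trans (opnormD _ _) _; apply: lerD.
Qed.

Lemma opnormM (R : realType) (m n p : nat) (A : 'M[R]_(m, n)) (B : 'M[R]_(n, p)) :
  opnorm (A *m B) <= opnorm A * opnorm B.
Proof.
apply: opnorm_le => [|x]; first by rewrite mulr_ge0 ?opnorm_ge0.
rewrite -mulmxA -mulrA; apply: le_trans (enorm_mulmx_le _ _) _.
by rewrite ler_wpM2l ?opnorm_ge0 ?enorm_mulmx_le.
Qed.

Lemma opnorm_outer (R : realType) (m n : nat) (x : 'cV[R]_m) (y : 'cV[R]_n) :
  opnorm (x *m y^T) <= enorm x * enorm y.
Proof.
apply: opnorm_le => [|z]; first by rewrite mulr_ge0 ?enorm_ge0.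
have -> : x *m y^T *m z = dotp y z *: x.
  by rewrite -mulmxA [y^T *m z]mx11_scalar mul_mx_scalar.
rewrite enormZ mulrC -mulrA ler_wpM2l ?enorm_ge0// ler_norml dotp_le_enorm andbT.
rewrite lerNl -(enormN y); apply: le_trans (dotp_le_enorm _ _).
by rewrite !dotpE -sumrN ler_sum// => i _; rewrite mxE mulNr.
Qed.

(** With [y = A^T x], the square of [enorm y] is [dotp x (A y)], at most
    [opnorm A * enorm x * enorm y] by Cauchy-Schwarz; one factor [enorm y] cancels. *)
Lemma opnorm_tr (R : realType) (m n : nat) (A : 'M[R]_(m, n)) :
  opnorm A^T <= opnorm A.
Proof.
apply: opnorm_le => [|x]; first exact: opnorm_ge0.
set y := A^T *m x.
have yy : enorm y ^+ 2 <= opnorm A * enorm x * enorm y.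
  rewrite sqr_enorm.
  have -> : dotp y y = dotp x (A *m y) by rewrite /dotp trmx_mul trmxK mulmxA.
  apply: le_trans (dotp_le_enorm _ _) _.
  by rewrite mulrC mulrAC ler_wpM2r ?enorm_ge0 ?enorm_mulmx_le.
have := enorm_ge0 y; rewrite le_eqVlt => /predU1P[<-|y0].
  by rewrite mulr_ge0 ?opnorm_ge0 ?enorm_ge0.
by rewrite -(ler_pM2r y0) -expr2.
Qed.

(** * Inner products, unit vectors and the shift matrix *)

Lemma dotpC (R : realType) (n : nat) (x y : 'cV[R]_n) : dotp x y = dotp y x.
Proof. by rewrite !dotpE; apply: eq_bigr => i _; rewrite mulrC. Qed.

Lemma dotpDr (R : realType) (n : nat) (x y z : 'cV[R]_n) :
  dotp x (y + z) = dotp x y + dotp x z.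
Proof. by rewrite /dotp mulmxDr mxE. Qed.

Lemma dotpZr (R : realType) (n : nat) (a : R) (x y : 'cV[R]_n) :
  dotp x (a *: y) = a * dotp x y.
Proof. by rewrite /dotp -scalemxAr mxE. Qed.

Lemma dotpNr (R : realType) (n : nat) (x y : 'cV[R]_n) : dotp x (- y) = - dotp x y.
Proof. by rewrite /dotp mulmxN mxE. Qed.

Lemma dotpBr (R : realType) (n : nat) (x y z : 'cV[R]_n) :
  dotp x (y - z) = dotp x y - dotp x z.
Proof. by rewrite dotpDr dotpNr. Qed.

Lemma dotp_mulmx (R : realType) (m n : nat) (A : 'M[R]_(m, n)) (x : 'cV[R]_m) (y : 'cV[R]_n) :
  dotp x (A *m y) = dotp (A^T *m x) y.
Proof. by rewrite /dotp trmx_mul trmxK mulmxA. Qed.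

Lemma outer_mulmx (R : realType) (m n : nat) (x : 'cV[R]_m) (y z : 'cV[R]_n) :
  x *m y^T *m z = dotp y z *: x.
Proof. by rewrite -mulmxA [y^T *m z]mx11_scalar mul_mx_scalar. Qed.

Lemma sqr_enormB (R : realType) (n : nat) (a : R) (x y : 'cV[R]_n) :
  enorm (x - a *: y) ^+ 2 = enorm x ^+ 2 - 2 * a * dotp x y + a ^+ 2 * enorm y ^+ 2.
Proof.
rewrite !sqr_enorm dotpBr dotpZr ![dotp (x - _) _]dotpC !dotpBr !dotpZr (dotpC y x).
by ring.
Qed.

Lemma e_coord (R : realType) (n k : nat) (i : 'I_n) :
  e_ R n k i 0 = (i.+1 == k)%:R.
Proof. by rewrite mxE. Qed.

Lemma dotp_e (R : realType) (n : nat) (x : 'cV[R]_n) (i : 'I_n) :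
  dotp (e_ R n i.+1) x = x i 0.
Proof.
rewrite dotpE (bigD1 i)//= e_coord eqxx mul1r big1 ?addr0// => l li.
by rewrite e_coord eqSS (negbTE li : (l == i :> nat) = false) mul0r.
Qed.

Lemma e_eq0 (R : realType) (n k : nat) : k = 0%N \/ (n < k)%N -> e_ R n k = 0.
Proof.
move=> k0; apply/colP => i; rewrite e_coord mxE; case: eqP => // ik.
by case: k0; rewrite -ik// ltnNge ltn_ord.
Qed.

Lemma e_neq0 (R : realType) (n k : nat) : (0 < k <= n)%N -> e_ R n k != 0.
Proof.
case: k => // k kn; apply/eqP => /colP /(_ (Ordinal kn)) /eqP.
by rewrite e_coord mxE eqxx oner_eq0.
Qed.

Lemma ZmxE (R : realType) (n : nat) (i l : 'I_n) :
  Zmx R n i l = (i == l.+1 :> nat)%:R.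
Proof.
rewrite /Zmx summxE.
under eq_bigr => k _.
  have -> : (e_ R n k.+1 *m (e_ R n k)^T) i l = if k == l.+1 then (i == l.+1 :> nat)%:R else 0.
    rewrite mxE big_ord1 !mxE eqSS (eq_sym l.+1); case: (eqVneq k) => [->|_]; last by rewrite mulr0.
    by rewrite mulr1.
  over.
rewrite -big_mkcond big_nat1_eq /=; case: ltnP => // ln.
by case: eqP => // il; move: (ltn_ord i); rewrite il ltnNge ln.
Qed.

Lemma Zmx_mul0 (R : realType) (n : nat) (x : 'cV[R]_n) (i : 'I_n) :
  i = 0%N :> nat -> (Zmx R n *m x) i 0 = 0.
Proof. by move=> i0; rewrite mxE big1// => l _; rewrite ZmxE i0 mul0r. Qed.

Lemma Zmx_mulS (R : realType) (n : nat) (x : 'cV[R]_n) (i l : 'I_n) :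
  i = l.+1 :> nat -> (Zmx R n *m x) i 0 = x l 0.
Proof.
move=> il; rewrite mxE (bigD1 l)//= ZmxE il eqxx mul1r big1 ?addr0// => m ml.
by rewrite ZmxE il eqSS eq_sym (negbTE ml : (m == l :> nat) = false) mul0r.
Qed.

(** Since [e_ R n 0] is zero, the first unit vector is sent to 0 without a separate case. The bound
    [k <= n] matters: at [k = n.+1] the left side is 0 while the right side is the last unit vector,
    nonzero for positive [n]. *)
Lemma tr_Zmx_e (R : realType) (n k : nat) :
  (k <= n)%N -> (Zmx R n)^T *m e_ R n k = e_ R n k.-1.
Proof.
move=> kn; apply/colP => l; rewrite mxE e_coord.
case: k kn => [|k] kn.
  by rewrite big1// => i _; rewrite e_coord mulr0.
rewrite (bigD1 (Ordinal kn))//= mxE ZmxE e_coord eqxx mulr1 big1 ?addr0 1?eq_sym//.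
move=> i ik; rewrite e_coord eqSS (_ : (i == k :> nat) = false) ?mulr0//.
by apply: contraNF ik => /eqP ik; apply/eqP/val_inj.
Qed.

(** The shift loses exactly the last coordinate, which is also why it never increases a norm. *)
Lemma tr_Zmx_mul_Zmx (R : realType) (n : nat) :
  (Zmx R n)^T *m Zmx R n = 1%:M - e_ R n n *m (e_ R n n)^T.
Proof.
apply/matrixP => i l; rewrite !mxE big_ord1 !mxE.
have [iN|iN] := eqVneq i.+1 n.
  rewrite mul1r big1 => [|m _].
    have [lN|lN] := eqVneq l.+1 n; last first.
      rewrite subr0 (_ : (i == l) = false)//; apply: contraNF lN => /eqP <-.
      exact/eqP.
    rewrite (_ : (i == l) = true) ?subrr//; apply/eqP/val_inj/succn_inj => /=.
    by rewrite iN lN.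
  rewrite mxE !ZmxE (_ : (m == i.+1 :> nat) = false) ?mul0r//.
  by apply/negP => /eqP mi; move: (ltn_ord m); rewrite mi iN ltnn.
rewrite mul0r subr0.
have iN' : (i.+1 < n)%N by rewrite ltn_neqAle iN ltn_ord.
rewrite (bigD1 (Ordinal iN'))//= mxE !ZmxE/= eqxx mul1r eqSS big1 ?addr0// => m mi.
rewrite mxE !ZmxE (_ : (m == i.+1 :> nat) = false) ?mul0r//.
by apply: contraNF mi => /eqP mi; apply/eqP/val_inj.
Qed.

Lemma sqr_enorm_Zmx (R : realType) (n : nat) (x : 'cV[R]_n) :
  enorm (Zmx R n *m x) ^+ 2 = enorm x ^+ 2 - dotp (e_ R n n) x ^+ 2.
Proof.
rewrite !sqr_enorm dotp_mulmx mulmxA tr_Zmx_mul_Zmx mulmxBl mul1mx outer_mulmx.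
by rewrite dotpC dotpBr dotpZr (dotpC x (e_ _ _ _)) expr2.
Qed.

Lemma enorm_Zmx_le (R : realType) (n : nat) (x : 'cV[R]_n) :
  enorm (Zmx R n *m x) <= enorm x.
Proof.
rewrite -(@ler_pXn2r _ 2)// ?nnegrE ?enorm_ge0// sqr_enorm_Zmx.
by rewrite lerBlDr lerDl sqr_ge0.
Qed.

Lemma opnorm_Zmx_le1 (R : realType) (n : nat) : opnorm (Zmx R n) <= 1.
Proof. by apply: opnorm_le => // x; rewrite mul1r enorm_Zmx_le. Qed.

Lemma Zpow0 (R : realType) (n : nat) : Zpow R n 0 = 1%:M.
Proof. by rewrite /Zpow expr0. Qed.

Lemma ZpowS (R : realType) (n j : nat) : Zpow R n j.+1 = Zmx R n *m Zpow R n j.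
Proof. by rewrite /Zpow exprS. Qed.

Lemma ZpowSr (R : realType) (n j : nat) : Zpow R n j.+1 = Zpow R n j *m Zmx R n.
Proof. by rewrite /Zpow exprSr. Qed.

Lemma opnorm_Zpow_le1 (R : realType) (n j : nat) : opnorm (Zpow R n j) <= 1.
Proof.
elim: j => [|j IH]; first by apply: opnorm_le => // x; rewrite Zpow0 !mul1mx mul1r.
rewrite ZpowS; apply: le_trans (opnormM _ _) _.
by rewrite mulr_ile1 ?opnorm_ge0 ?opnorm_Zmx_le1.
Qed.

Lemma opnorm_Zpow_conj (R : realType) (n j : nat) (A : 'M[R]_n) :
  opnorm (Zpow R n j *m A *m (Zpow R n j)^T) <= opnorm A.
Proof.
have Zj := opnorm_Zpow_le1 R n j.
apply: le_trans (opnormM _ _) _; rewrite -[leRHS]mulr1.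
apply: ler_pM; rewrite ?opnorm_ge0//; last exact: le_trans (opnorm_tr _) Zj.
apply: le_trans (opnormM _ _) _; rewrite -[leRHS]mul1r.
by rewrite ler_wpM2r ?opnorm_ge0.
Qed.

(** * Leading zeros and nilpotency of the shift *)

(** Positions count from 1, so [k = 1] imposes nothing and [k = n.+1] forces the zero vector. *)
Definition zero_before (R : realType) (n k : nat) (x : 'cV[R]_n) :=
  forall i : 'I_n, (i.+1 < k)%N -> x i 0 = 0.

Lemma zero_before_Zmx (R : realType) (n k : nat) (x : 'cV[R]_n) :
  zero_before k x -> zero_before k.+1 (Zmx R n *m x).
Proof.
move=> x0 [[|i] iN] ik; first exact: Zmx_mul0.
by rewrite (@Zmx_mulS _ _ _ _ (Ordinal (ltnW iN)))// x0.
Qed.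

Lemma zero_before_eq0 (R : realType) (n k : nat) (x : 'cV[R]_n) :
  (n < k)%N -> zero_before k x -> x = 0.
Proof.
move=> nk x0; apply/colP => i; rewrite mxE x0//.
exact: leq_ltn_trans (ltn_ord i) nk.
Qed.

Lemma zero_beforeB (R : realType) (n k : nat) (a : R) (x y : 'cV[R]_n) :
  zero_before k x -> zero_before k y -> zero_before k (x - a *: y).
Proof. by move=> x0 y0 i ik; rewrite !mxE x0// y0// mulr0 subr0. Qed.

Lemma zero_beforeZ (R : realType) (n k : nat) (a : R) (x : 'cV[R]_n) :
  zero_before k x -> zero_before k (a *: x).
Proof. by move=> x0 i ik; rewrite !mxE x0// mulr0. Qed.

Lemma zero_before_e (R : realType) (n k : nat) : zero_before k (e_ R n k).
Proof. by move=> i ik; rewrite e_coord ltn_eqF. Qed.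

Lemma zero_before_dotp (R : realType) (n j k : nat) (x : 'cV[R]_n) :
  (j < k)%N -> zero_before k x -> dotp (e_ R n j) x = 0.
Proof.
move=> jk x0; rewrite dotpE big1// => i _; rewrite e_coord.
by case: eqP => [ij|_]; rewrite ?mul0r// x0 ?mulr0// ij.
Qed.

Lemma zero_beforeS (R : realType) (n k : nat) (x : 'cV[R]_n) :
  zero_before k x -> dotp (e_ R n k) x = 0 -> zero_before k.+1 x.
Proof.
move=> x0 xk i; rewrite ltnS leq_eqVlt => /predU1P[ik|]; last exact: x0.
by rewrite -xk -ik dotp_e.
Qed.

Lemma zero_before_Zpow (R : realType) (n k j : nat) (x : 'cV[R]_n) :
  zero_before k x -> zero_before (j + k) (Zpow R n j *m x).
Proof.
move=> x0; elim: j => [|j IH]; first by rewrite Zpow0 mul1mx.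
by rewrite ZpowS -mulmxA addSn; apply: zero_before_Zmx.
Qed.

Lemma Zpow_size (R : realType) (n : nat) : Zpow R n n = 0.
Proof.
apply/matrixP => i l.
have : Zpow R n n *m (delta_mx l 0 : 'cV[R]_n) = 0.
  by apply: (@zero_before_eq0 _ _ (n + 1)); [rewrite addn1 | apply: zero_before_Zpow].
by rewrite -colE => /colP /(_ i); rewrite !mxE.
Qed.

(** * Exactness of the downdating recursion *)

(* Invariant of the recursion: [A] is the Schur complement of [T] left after
   the first [k.-1] steps, bordered by zeros. *)
Definition schur_complement (R : realType) (n k : nat) (A : 'M[R]_n) (u v : 'cV[R]_n) :=
  [/\ A^T = A,
      A - Zmx R n *m A *m (Zmx R n)^T = u *m u^T - v *m v^T,
      forall j, (j < k)%N -> A *m e_ R n j = 0,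
      forall x, x != 0 -> zero_before k x -> 0 < dotp x (A *m x) &
      zero_before k u /\ zero_before k.+1 v].

(** Apply the displacement equation to the [k]-th unit vector: the shifted term vanishes because [A]
    kills the preceding one, and [v] has a zero there. So [u] is the pivot column of [A] up to
    scaling, and positivity of [A] makes the pivot nonzero. *)
Lemma schur_complement_pivot (R : realType) (n k : nat) (A : 'M[R]_n) (u v : 'cV[R]_n) :
  (0 < k <= n)%N -> schur_complement k A u v ->
  A *m e_ R n k = dotp (e_ R n k) u *: u /\ 0 < dotp (e_ R n k) u ^+ 2.
Proof.
move=> k0n [_ disp ker pos [_ v0]]; have /andP[k0 kn] := k0n.
have Ae : A *m e_ R n k = dotp (e_ R n k) u *: u.
  have -> : A = Zmx R n *m A *m (Zmx R n)^T + (u *m u^T - v *m v^T).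
    by rewrite -disp addrC subrK.
  rewrite mulmxDl mulmxBl !outer_mulmx -!mulmxA tr_Zmx_e// ker ?prednK//.
  by rewrite mulmx0 add0r !(dotpC _ (e_ _ _ _)) (zero_before_dotp (ltnSn k) v0) scale0r subr0.
split=> //; have := pos _ (e_neq0 R k0n) (@zero_before_e R n k).
by rewrite Ae dotpZr expr2.
Qed.

(** Subtracting [u u^T] is one step of Cholesky elimination, since [u] is the scaled pivot column.
    Positivity of the new complement comes from completing the square. *)
Lemma schur_complement_next (R : realType) (n k : nat) (A : 'M[R]_n) (u v : 'cV[R]_n) :
  (0 < k <= n)%N -> schur_complement k A u v ->
  let B := A - u *m u^T in
  [/\ B^T = B, B = Zmx R n *m A *m (Zmx R n)^T - v *m v^T,
      forall j, (j < k.+1)%N -> B *m e_ R n j = 0 &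
      forall x, x != 0 -> zero_before k.+1 x -> 0 < dotp x (B *m x)].
Proof.
move=> kn inv; have [Ae p0] := schur_complement_pivot kn inv.
case: inv => symA disp ker pos [u0 v0] B.
have mulB x : B *m x = A *m x - dotp u x *: u by rewrite mulmxBl outer_mulmx.
split.
- by rewrite /B linearB/= trmx_mul trmxK symA.
- by rewrite /B; apply/eqP; rewrite subr_eq addrAC -[X in _ == X]addrA -disp addrC subrK.
- move=> j; rewrite ltnS leq_eqVlt mulB dotpC => /predU1P[->|jk].
    by rewrite Ae subrr.
  by rewrite ker// (zero_before_dotp jk u0) scale0r subrr.
move=> x x_neq0 x0; set p := dotp (e_ R n k) u in Ae p0.
have p_neq0 : p != 0 by apply: contraTneq p0 => ->; rewrite expr0n ltxx.
(* This multiple of the pivot vector minimizes the quadratic form of [A] along [x - t e_k], and the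
   minimum is the form of [B] at [x]. *)
set y := x - (dotp u x / p) *: e_ R n k.
have y0 : zero_before k y.
  apply: zero_beforeB (@zero_before_e _ _ _) => i ik; exact/x0/ltnW.
have y_neq0 : y != 0.
  apply: contra x_neq0 => /eqP yE; apply/eqP/colP => i.
  have := congr1 (fun z : 'cV[R]_n => z i 0) yE; rewrite !mxE.
  case: eqP => [ik|_]; last by rewrite mulr0 subr0.
  by rewrite x0// ik.
have := pos y y_neq0 y0.
have -> : dotp y (A *m y) = dotp x (B *m x).
  rewrite mulB /y mulmxBr -scalemxAr Ae dotpBr dotpBr !dotpZr.
  rewrite !(dotpC (x - _)) !dotpBr !dotpZr -!(dotpC (e_ R n k)) -/p (dotpC (A *m x)).
  rewrite (dotp_mulmx A (e_ _ _ _)) symA Ae !(dotpC (p *: u)) !dotpZr (dotpC x u).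
  rewrite ?(dotpC u (e_ R n k)) -/p.
  by field.
by [].
Qed.

Lemma Hrot_mul_rows (R : realType) (n : nat) (t : R) (x y x' y' : 'cV[R]_n) :
  col_mx x'^T y'^T = Hrot t *m col_mx x^T y^T ->
  x' = (cos t)^-1 *: (x - sin t *: y) /\ y' = (cos t)^-1 *: (y - sin t *: x).
Proof.
move=> H; split; apply/colP => i.
  have := congr1 (fun M : 'M[R]_(1 + 1, n) => M (lshift 1 0) i) H.
  rewrite col_mxEu mxE => ->; rewrite mxE big_split_ord !big_ord1.
  by rewrite col_mxEu col_mxEd !mxE/=; ring.
have := congr1 (fun M : 'M[R]_(1 + 1, n) => M (rshift 1 0) i) H.
rewrite col_mxEd mxE => ->; rewrite mxE big_split_ord !big_ord1.
by rewrite col_mxEu col_mxEd !mxE/=; ring.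
Qed.

Lemma hyperbolic_outer (R : realType) (n : nat) (s c : R) (x y : 'cV[R]_n) :
  c != 0 -> s ^+ 2 + c ^+ 2 = 1 ->
  let x' := c^-1 *: (x - s *: y) in let y' := c^-1 *: (y - s *: x) in
  x' *m x'^T - y' *m y'^T = x *m x^T - y *m y^T.
Proof.
move=> c0 sc /=; apply/matrixP => i l; rewrite !mxE !big_ord1 !mxE.
have {sc} cE : 1 - s ^+ 2 = c ^+ 2 by rewrite -sc addrAC subrr add0r.
transitivity ((1 - s ^+ 2) / c ^+ 2 * (x i 0 * x l 0 - y i 0 * y l 0)).
  by field.
by rewrite cE divff ?mul1r// expf_eq0.
Qed.

Lemma opnorm_Hrot_le (R : realType) (t : R) : 0 < cos t -> opnorm (Hrot t) <= 2 / cos t.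
Proof.
move=> c0; apply: le_trans (opnormZ_le _ _) _.
have ci0 : 0 <= (cos t)^-1 by rewrite invr_ge0 ltW.
rewrite ger0_norm// [leLHS]mulrC ler_wpM2r//.
apply: opnorm_le => // x.
rewrite -(@ler_pXn2r _ 2)// ?nnegrE ?mulr_ge0 ?enorm_ge0// exprMn.
rewrite !sqr_enorm !dotpE !big_split_ord !big_ord1 /= !mxE !big_split_ord !big_ord1 !mxE /=.
set a := x _ 0; set b := x _ 0; have := cos2Dsin2 t.
set s := sin t; set c := cos t => sc.
(* The closing [nra] rests on the identity [4(a^2+b^2) - (a-sb)^2 - (b-sa)^2 = (a+sb)^2 + (b+sa)^2 +
   2(1-s^2)(a^2+b^2)]. *)
have s1 : 0 <= 1 - s ^+ 2 by rewrite -sc addrK sqr_ge0.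
have ha : 0 <= (1 - s ^+ 2) * a ^+ 2 by rewrite mulr_ge0 ?sqr_ge0.
have hb : 0 <= (1 - s ^+ 2) * b ^+ 2 by rewrite mulr_ge0 ?sqr_ge0.
have := sqr_ge0 (a + s * b); have := sqr_ge0 (b + s * a); nra.
Qed.

Lemma schur_complement_step (R : realType) (n k : nat) (A : 'M[R]_n)
    (u v u' v' : 'cV[R]_n) (t : R) :
  (0 < k < n)%N -> schur_complement k A u v ->
  sin t = dotp (e_ R n k.+1) v / dotp (e_ R n k) u ->
  cos t = Num.sqrt (1 - sin t ^+ 2) ->
  col_mx u'^T v'^T = Hrot t *m col_mx (u^T *m (Zmx R n)^T) v^T ->
  0 < cos t /\ schur_complement k.+1 (A - u *m u^T) u' v'.
Proof.
move=> /andP[k0 kn] inv sE cE uvE.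
have k0n : (0 < k <= n)%N by rewrite k0 ltnW.
have [Ae p0] := schur_complement_pivot k0n inv.
have [symB BE kerB posB] := schur_complement_next k0n inv.
case: inv => symA disp ker pos [u0 v0].
set p := dotp (e_ R n k) u in Ae p0 sE; set q := dotp (e_ R n k.+1) v in sE.
have p_neq0 : p != 0 by apply: contraTneq p0 => ->; rewrite expr0n ltxx.
(* The next pivot equals [p^2 - q^2], so its positivity gives [|q| < |p|], that is [|sin t| < 1] and
   a positive cosine. *)
have eBe : dotp (e_ R n k.+1) ((A - u *m u^T) *m e_ R n k.+1) = p ^+ 2 - q ^+ 2.
  rewrite BE mulmxBl outer_mulmx -!mulmxA tr_Zmx_e// Ae -scalemxAr dotpBr !dotpZr.
  by rewrite dotp_mulmx tr_Zmx_e// (dotpC v) !expr2.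
have s1 : sin t ^+ 2 < 1.
  have := posB _ (@e_neq0 R n k.+1 kn) (@zero_before_e R n k.+1).
  by rewrite eBe subr_gt0 sE expr_div_n ltr_pdivrMr ?mul1r.
have c0 : 0 < cos t by rewrite cE sqrtr_gt0 subr_gt0.
rewrite -trmx_mul in uvE.
have [u'E v'E] := Hrot_mul_rows uvE.
have sc : sin t ^+ 2 + cos t ^+ 2 = 1 by rewrite addrC cos2Dsin2.
split=> //; split=> //; last first.
  have Zu0 := zero_before_Zmx u0.
  split.
    by rewrite u'E; apply/zero_beforeZ/zero_beforeB.
  (* The shift already gives [k] leading zeros; the choice of [sin t] as [q / p] cancels entry
     [k.+1] of [v'] as well. *)
  apply: zero_beforeS; first by rewrite v'E; apply/zero_beforeZ/zero_beforeB.
  by rewrite v'E dotpZr dotpBr dotpZr dotp_mulmx tr_Zmx_e// -/p -/q sE divfK// subrr mulr0.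
rewrite u'E v'E (hyperbolic_outer _ _ (lt0r_neq0 c0) sc) {1}BE mulmxBr mulmxBl.
by rewrite trmx_mul !mulmxA opprB addrC addrA subrK.
Qed.

Definition downdating_vectors (R : realType) (n : nat) (u_ v_ : nat -> 'cV[R]_n)
    (theta : nat -> R) :=
  forall k, (0 < k < n)%N ->
    [/\ 0 < cos (theta k),
        u_ k.+1 = (cos (theta k))^-1 *: (Zmx R n *m u_ k - sin (theta k) *: v_ k) &
        v_ k.+1 = (cos (theta k))^-1 *: (v_ k - sin (theta k) *: (Zmx R n *m u_ k))].

(** The invariant survives to [k = n]. One last elimination leaves a matrix killing every unit
    vector, hence zero, which is the Cholesky factorization of [T]. At [k = n] the leading zeros
    leave [u_ n] only its last entry and [v_ n] none. *)
Lemma downdating_exact (R : realType) (n : nat) (T : 'M[R]_n) (u v : 'cV[R]_n)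
    (u_ v_ : nat -> 'cV[R]_n) (theta : nat -> R) :
  (0 < n)%N -> posdef T -> generators T u v -> downdating u v u_ v_ theta ->
  [/\ T = \sum_(1 <= k < n.+1) u_ k *m (u_ k)^T, Zmx R n *m u_ n = 0, v_ n = 0 &
      downdating_vectors u_ v_ theta].
Proof.
move=> n0 [symT posT] [disp v1] [u1E v1E rec].
pose A k := T - \sum_(1 <= i < k) u_ i *m (u_ i)^T.
have AS k : (0 < k)%N -> A k.+1 = A k - u_ k *m (u_ k)^T.
  by move=> k0; rewrite /A big_nat_recr//= opprD addrA.
have inv k : (0 < k <= n)%N -> schur_complement k (A k) (u_ k) (v_ k).
  elim: k => // -[_ _|k IH kn].
    rewrite /A big_nil subr0 u1E v1E; split=> // [[]// _|x x0 _|].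
    - by rewrite e_eq0 ?mulmx0//; left.
    - exact: posT.
    - by split=> //; apply: zero_beforeS => //; rewrite dotpC.
  have kn' : (0 < k.+1 < n)%N := kn.
  have [sE cE uvE] := rec _ kn'.
  have k0n : (0 < k.+1 <= n)%N := ltnW kn.
  by have [_] := schur_complement_step kn' (IH k0n) sE cE uvE; rewrite -(AS k.+1).
have n0n : (0 < n <= n)%N by rewrite n0 leqnn.
have invn := inv _ n0n; have [_ _ _ _ [un0 vn0]] := invn.
split.
- have [_ _ ker _] := schur_complement_next n0n invn.
  apply/eqP; rewrite -subr_eq0 -/(A n.+1) AS//; apply/eqP/matrixP => i l.
  have := ker l.+1 (ltn_ord l) => /(congr1 (dotp (e_ R n i.+1))).
  rewrite !dotp_e [RHS]mxE mxE (bigD1 l)//= e_coord eqxx mulr1 big1 ?addr0.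
    by move=> ->; rewrite mxE.
  move=> m ml.
  by rewrite e_coord eqSS (negbTE ml : (m == l :> nat) = false) mulr0.
- exact: zero_before_eq0 (ltnSn n) (zero_before_Zmx un0).
- exact: zero_before_eq0 (ltnSn n) vn0.
move=> k kn; have [sE cE uvE] := rec k kn.
have k0n : (0 < k <= n)%N by case/andP: kn => -> /ltnW.
have [c0 _] := schur_complement_step kn (inv k k0n) sE cE uvE.
by rewrite -trmx_mul in uvE; have [] := Hrot_mul_rows uvE.
Qed.

(** * Growth of the exact vectors *)

Lemma ler_sqr_enorm (R : realType) (m n : nat) (x : 'cV[R]_m) (y : 'cV[R]_n) :
  (enorm x ^+ 2 <= enorm y ^+ 2) = (enorm x <= enorm y).
Proof. by rewrite ler_pXn2r// nnegrE enorm_ge0. Qed.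

Lemma hyperbolic_sqr_enorm (R : realType) (n : nat) (s c : R) (x y : 'cV[R]_n) :
  c != 0 -> s ^+ 2 + c ^+ 2 = 1 ->
  enorm (c^-1 *: (x - s *: y)) ^+ 2 - enorm (c^-1 *: (y - s *: x)) ^+ 2 =
  enorm x ^+ 2 - enorm y ^+ 2.
Proof.
move=> c0 sc; rewrite !enormZ !exprMn real_normK ?num_real// !sqr_enormB (dotpC y x).
have {sc} cE : 1 - s ^+ 2 = c ^+ 2 by rewrite -sc addrAC subrr add0r.
transitivity ((1 - s ^+ 2) / c ^+ 2 * (enorm x ^+ 2 - enorm y ^+ 2)).
  by field.
by rewrite cE divff ?mul1r// expf_eq0.
Qed.

(** The rotation mixes whole vectors, so it commutes with [Zpow R n j], and a hyperbolic rotation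
    preserves the difference of squared norms. *)
Lemma downdating_sqr_enorm (R : realType) (n : nat) (u_ v_ : nat -> 'cV[R]_n) (theta : nat -> R)
    (j k : nat) :
  downdating_vectors u_ v_ theta -> (0 < k < n)%N ->
  enorm (Zpow R n j *m u_ k.+1) ^+ 2 - enorm (Zpow R n j *m v_ k.+1) ^+ 2 =
  enorm (Zpow R n j.+1 *m u_ k) ^+ 2 - enorm (Zpow R n j *m v_ k) ^+ 2.
Proof.
move=> rec kn; have [c0 -> ->] := rec k kn.
rewrite -!scalemxAr !mulmxBr -!scalemxAr mulmxA -ZpowSr hyperbolic_sqr_enorm ?gt_eqF//.
by rewrite addrC cos2Dsin2.
Qed.

Lemma downdating_v_le_u (R : realType) (n : nat) (u_ v_ : nat -> 'cV[R]_n) (theta : nat -> R)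
    (j k : nat) :
  downdating_vectors u_ v_ theta -> v_ n = 0 -> (0 < k <= n)%N ->
  enorm (Zpow R n j *m v_ k) <= enorm (Zpow R n j *m u_ k).
Proof.
move=> rec vn /andP[k0 kn].
(* Descending induction, started from [v_ n = 0]. The conservation law carries the inequality at
   [k.+1] back to [k] with one extra shift on [u_ k], which can only shrink it. *)
elim: {kn}(n - k)%N {-2}k k0 (subnK kn) => [|m IH] {}k k0 mk.
  by rewrite -[k]add0n mk vn mulmx0 enorm0 enorm_ge0.
have kn : (0 < k < n)%N by rewrite k0 -mk addSn ltnS leq_addl.
have := IH k.+1 isT; rewrite addnS -addSn => /(_ mk).
rewrite -(ler_sqr_enorm (_ *m v_ k.+1)) -(ler_sqr_enorm (_ *m v_ k)).
rewrite -subr_ge0 (downdating_sqr_enorm _ rec kn) -(subr_ge0 (_ ^+ 2)) => h.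
apply: le_trans h _; rewrite lerD2r ZpowS -mulmxA sqr_enorm_Zmx.
by rewrite lerBlDr lerDl sqr_ge0.
Qed.

Lemma downdating_v_le_Zu (R : realType) (n : nat) (u_ v_ : nat -> 'cV[R]_n) (theta : nat -> R)
    (j k : nat) :
  downdating_vectors u_ v_ theta -> v_ n = 0 -> (0 < k <= n)%N ->
  enorm (Zpow R n j *m v_ k) <= enorm (Zpow R n j.+1 *m u_ k).
Proof.
move=> rec vn /andP[k0]; rewrite leq_eqVlt => /predU1P[->|kn].
  by rewrite vn mulmx0 enorm0 enorm_ge0.
have kn' : (0 < k < n)%N by rewrite k0.
rewrite -ler_sqr_enorm -subr_ge0 -(downdating_sqr_enorm _ rec kn') subr_ge0.
by rewrite ler_sqr_enorm (downdating_v_le_u _ rec).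
Qed.

(* Each shift gains one term [cos * enorm (Z_i u_ k)], and [Z_n = 0] ends the
   descent. *)
Lemma downdating_u_le_cos (R : realType) (n : nat) (u_ v_ : nat -> 'cV[R]_n) (theta : nat -> R)
    (j k : nat) :
  downdating_vectors u_ v_ theta -> v_ n = 0 -> (0 < k < n)%N -> (j < n)%N ->
  enorm (Zpow R n j *m u_ k.+1) <=
    cos (theta k) * (n - j.+1)%:R * enorm (Zpow R n j.+1 *m u_ k).
Proof.
move=> rec vn kn jn; have [c0 uE vE] := rec k kn.
(* Eliminating [v_ k] in favour of [v_ k.+1] turns the factor [1 / cos] into [cos], which later
   cancels the growth of the rotation. *)
have mixed : u_ k.+1 = cos (theta k) *: (Zmx R n *m u_ k) - sin (theta k) *: v_ k.+1.
  rewrite vE uE; apply/colP => i; rewrite !mxE.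
  set x := \sum_(_ < _) _; have := cos2Dsin2 (theta k) => sc.
  have c_neq0 := lt0r_neq0 c0.
  rewrite -[in LHS](mul1r x) -sc.
  by field.
have step i : enorm (Zpow R n i *m u_ k.+1) <=
    cos (theta k) * enorm (Zpow R n i.+1 *m u_ k) + enorm (Zpow R n i.+1 *m u_ k.+1).
  rewrite {1}mixed mulmxBr -!scalemxAr mulmxA -ZpowSr.
  apply: le_trans (enormD _ _) _; rewrite enormN !enormZ (gtr0_norm c0) lerD2l.
  have k1n : (0 < k.+1 <= n)%N by case/andP: kn.
  apply: le_trans (downdating_v_le_Zu i rec vn k1n); rewrite -[leRHS]mul1r.
  rewrite ler_wpM2r ?enorm_ge0// ler_norml; apply/andP; split; last exact: sin_le1.
  exact: sin_geN1.
(* Here [m] counts the shifts left before [Zpow R n n = 0], so the induction lowers [m] while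
   raising [i]. *)
suff claim m i : (m + i.+1)%N = n ->
    enorm (Zpow R n i *m u_ k.+1) <= cos (theta k) * m%:R * enorm (Zpow R n i.+1 *m u_ k).
  by apply: claim; rewrite subnK.
elim: m i => [|m IH] i mi.
  apply: le_trans (step i) _.
  by rewrite mulr0 mul0r -[i.+1]add0n mi Zpow_size !mul0mx !enorm0 mulr0 addr0.
apply: le_trans (step i) _; rewrite -natr1 mulrDr mulr1 mulrDl addrC lerD2r.
have := IH i.+1; rewrite addnS -addSn => /(_ mi) h; apply: le_trans h _.
rewrite ler_wpM2l//; first by rewrite mulr_ge0// ltW.
by rewrite (ZpowS _ _ i.+1) -mulmxA enorm_Zmx_le.
Qed.

(** The constant is [8 = 2 * 2 * 2]: one 2 from [opnorm (Hrot _) <= 2 / cos], and one from each sum,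
    whose [v] term is dominated by its partner. The cosine in the bound on [u_ k.+1] cancels the
    denominator. *)
Lemma downdating_growth (R : realType) (n : nat) (u_ v_ : nat -> 'cV[R]_n) (theta : nat -> R)
    (j k : nat) :
  downdating_vectors u_ v_ theta -> v_ n = 0 -> (0 < k < n)%N -> (j < n)%N ->
  opnorm (Hrot (theta k)) *
    (enorm (Zpow R n j.+1 *m u_ k) + enorm (Zpow R n j *m v_ k)) *
    (enorm (Zpow R n j *m u_ k.+1) + enorm (Zpow R n j *m v_ k.+1)) <=
  8 * ((n - j.+1)%:R * enorm (Zpow R n j.+1 *m u_ k) ^+ 2).
Proof.
move=> rec vn kn jn; have [c0 _ _] := rec k kn.
have k0n : (0 < k <= n)%N by case/andP: kn => -> /ltnW.
have k1n : (0 < k.+1 <= n)%N by case/andP: kn.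
have := downdating_v_le_Zu j rec vn k0n; have := downdating_v_le_u j rec vn k1n.
have := downdating_u_le_cos rec vn kn jn.
set a := enorm (_ *m u_ k); set b := enorm (_ *m v_ k).
set a' := enorm (_ *m u_ k.+1); set b' := enorm (_ *m v_ k.+1).
set m : R := _%:R => a'E b'a' ba.
have a0 : 0 <= a := enorm_ge0 _; have b0 : 0 <= b := enorm_ge0 _.
have a'0 : 0 <= a' := enorm_ge0 _; have b'0 : 0 <= b' := enorm_ge0 _.
apply: (@le_trans _ _ (2 / cos (theta k) * (2 * a) * (2 * (cos (theta k) * m * a)))); last first.
  rewrite le_eqVlt; apply/orP; left; apply/eqP; field; exact: lt0r_neq0.
have H0 := opnorm_ge0 (Hrot (theta k)).
apply: ler_pM; [by rewrite mulr_ge0// addr_ge0 | by rewrite addr_ge0 | | lra].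
apply: ler_pM; rewrite ?addr_ge0//; last lra.
exact: opnorm_Hrot_le.
Qed.

(** * Traces and the summed growth factors *)

Lemma mxtrace_outer (R : realType) (n : nat) (x : 'cV[R]_n) : \tr (x *m x^T) = enorm x ^+ 2.
Proof. by rewrite mxtrace_mulC sqr_enorm /mxtrace big_ord1. Qed.

Lemma mxtrace_Zpow_conj (R : realType) (n j : nat) (T : 'M[R]_n) (u_ : nat -> 'cV[R]_n) :
  T = \sum_(1 <= k < n.+1) u_ k *m (u_ k)^T ->
  \tr (Zpow R n j *m T *m (Zpow R n j)^T) =
  \sum_(1 <= k < n.+1) enorm (Zpow R n j *m u_ k) ^+ 2.
Proof.
move=> ->; rewrite mulmx_sumr mulmx_suml raddf_sum; apply: eq_bigr => k _ /=.
by rewrite -mxtrace_outer trmx_mul !mulmxA.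
Qed.

Lemma sum_downdating_growth (R : realType) (n : nat) (T : 'M[R]_n)
    (u_ v_ : nat -> 'cV[R]_n) (theta : nat -> R) :
  (0 < n)%N -> T = \sum_(1 <= k < n.+1) u_ k *m (u_ k)^T ->
  downdating_vectors u_ v_ theta -> v_ n = 0 ->
  \sum_(j < n) \sum_(1 <= k < n) opnorm (Hrot (theta k)) *
    (enorm (Zpow R n j.+1 *m u_ k) + enorm (Zpow R n j *m v_ k)) *
    (enorm (Zpow R n j *m u_ k.+1) + enorm (Zpow R n j *m v_ k.+1)) <=
  8 * \sum_(1 <= j < n) (n - j)%:R * \tr (Zpow R n j *m T *m (Zpow R n j)^T).
Proof.
move=> n0 TE rec vn.
apply: (@le_trans _ _ (8 * \sum_(j < n) (n - j.+1)%:R *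
    \tr (Zpow R n j.+1 *m T *m (Zpow R n j.+1)^T))).
  rewrite mulr_sumr; apply: ler_sum => j _; rewrite (mxtrace_Zpow_conj _ TE).
  apply: (@le_trans _ _ (\sum_(1 <= k < n)
      8 * ((n - j.+1)%:R * enorm (Zpow R n j.+1 *m u_ k) ^+ 2))).
    by rewrite ler_sum_nat// => k kn; apply: downdating_growth.
  rewrite -!mulr_sumr ler_wpM2l// ler_wpM2l//.
  (* The trace sum runs to [k = n], one nonnegative term further than the recursion. *)
  by rewrite [leRHS]big_nat_recr//= lerDl sqr_ge0.
rewrite ler_wpM2l//.
(* Reindexing [j.+1] as [j] creates a term at [j = n], which vanishes through its weight [n - j]. *)
have shift (F : nat -> R) : F n = 0 -> \sum_(j < n) F j.+1 = \sum_(1 <= j < n) F j.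
  rewrite -(big_mkord xpredT (fun j => F j.+1)).
  by case: n n0 {T u_ v_ TE rec vn} => // m _ Fm; rewrite big_nat_recr//= Fm addr0 big_add1.
rewrite (shift (fun j => (n - j)%:R * \tr (Zpow R n j *m T *m (Zpow R n j)^T)))//.
by rewrite subnn mul0r.
Qed.

(** * Displacement equations and the bound at a fixed precision *)

(** Conjugating [D] by [Zpow R n j] gives consecutive differences of the conjugates of [A]; they
    telescope to [A] because the [n]-th power of the shift is zero. *)
Lemma opnorm_displacement (R : realType) (n : nat) (A D : 'M[R]_n) :
  A - Zmx R n *m A *m (Zmx R n)^T = D ->
  opnorm A <= \sum_(j < n) opnorm (Zpow R n j *m D *m (Zpow R n j)^T).
Proof.
move=> AD; pose f j := Zpow R n j *m A *m (Zpow R n j)^T.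
have -> : A = \sum_(j < n) Zpow R n j *m D *m (Zpow R n j)^T.
  rewrite -(big_mkord xpredT (fun j => Zpow R n j *m D *m (Zpow R n j)^T)).
  rewrite (eq_bigr (fun j => - (f j.+1 - f j))) => [|j _].
    rewrite sumrN telescope_sumr// /f Zpow_size Zpow0 !mul0mx mul1mx.
    by rewrite trmx1 mulmx1 sub0r opprK.
  by rewrite opprB /f -AD mulmxBr mulmxBl ZpowSr trmx_mul !mulmxA.
exact: opnorm_sum.
Qed.

(** Used with [M] and [N] the outer squares of the computed vectors and [m.+1] the matrix size.
    Summation cancels the interior [N] terms, leaving the initial generators and one boundary term
    at each of [N] and [M]. *)
Lemma displacement_sum (R : realType) (n : nat) (Z : 'M[R]_n) (M N F : nat -> 'M[R]_n) (m : nat) :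
  (forall k, (0 < k <= m)%N -> M k.+1 - N k.+1 = Z *m M k *m Z^T - N k + F k) ->
  \sum_(1 <= k < m.+2) M k - Z *m (\sum_(1 <= k < m.+2) M k) *m Z^T =
  M 1%N - N 1%N + \sum_(1 <= k < m.+1) F k + (N m.+1 - Z *m M m.+1 *m Z^T).
Proof.
elim: m => [|m IH] rec.
  by rewrite !big_nat1 big_geq// addr0 addrA subrK.
rewrite big_nat_recr//= mulmxDr mulmxDl opprD addrACA IH => [|k /andP[k0 km]]; last first.
  by apply: rec; rewrite k0 ltnW.
rewrite [\sum_(1 <= k < m.+2) F k]big_nat_recr//=.
have := rec m.+1; rewrite leqnn => /(_ isT) /eqP; rewrite subr_eq => /eqP ->.
apply/matrixP => i l; rewrite !mxE; ring.
Qed.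

Lemma opnorm_outer_diff (R : realType) (n : nat) (x y : 'cV[R]_n) :
  opnorm (x *m x^T - y *m y^T) <= 2 * enorm x * enorm (y - x) + enorm (y - x) ^+ 2.
Proof.
set d := y - x.
have -> : x *m x^T - y *m y^T = - (x *m d^T + d *m x^T + d *m d^T).
  rewrite (_ : y = x + d); last by rewrite addrC subrK.
  by rewrite linearD/= mulmxDl !mulmxDr; apply/matrixP => i l; rewrite !mxE; ring.
rewrite opnormN; apply: le_trans (opnormD _ _) _.
apply: lerD; last by rewrite expr2; exact: opnorm_outer.
apply: le_trans (opnormD _ _) _.
by have := opnorm_outer x d; have := opnorm_outer d x; lra.
Qed.

(** Non-asymptotic form of the estimate, with [F] for [eps *: G] and [Q] for the residual. The [F]
    terms stay conjugated because their bound depends on [j]; everything else is bounded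
    independently of [j], whence the factor [n]. The assumption on [v] lets [enorm u] serve as the
    common coefficient. *)
Lemma perturbation_bound (R : realType) (n : nat) (T : 'M[R]_n) (u v : 'cV[R]_n)
    (x y : nat -> 'cV[R]_n) (F Q : nat -> 'M[R]_n) :
  (0 < n)%N -> generators T u v -> enorm v <= enorm u ->
  (forall k, (0 < k < n)%N ->
    x k.+1 *m (x k.+1)^T - y k.+1 *m (y k.+1)^T =
    Zmx R n *m x k *m (x k)^T *m (Zmx R n)^T - y k *m (y k)^T + F k + Q k) ->
  opnorm (T - \sum_(1 <= k < n.+1) x k *m (x k)^T) <=
    2 * n%:R * enorm u * (enorm (x 1%N - u) + enorm (y 1%N - v)) +
    \sum_(j < n) \sum_(1 <= k < n) opnorm (Zpow R n j *m F k *m (Zpow R n j)^T) +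
    n%:R * (enorm (x 1%N - u) ^+ 2 + enorm (y 1%N - v) ^+ 2 +
            \sum_(1 <= k < n) opnorm (Q k) +
            (enorm (y n) ^+ 2 + enorm (Zmx R n *m x n) ^+ 2)).
Proof.
case: n => // n in T u v x y F Q * => _ [disp _] vu rec.
set S := \sum_(_ <= _ < _) _.
pose P := (u *m u^T - x 1%N *m (x 1%N)^T) - (v *m v^T - y 1%N *m (y 1%N)^T) -
  \sum_(1 <= k < n.+1) Q k -
  (y n.+1 *m (y n.+1)^T - (Zmx R n.+1 *m x n.+1) *m (Zmx R n.+1 *m x n.+1)^T).
have dispS : (T - S) - Zmx R n.+1 *m (T - S) *m (Zmx R n.+1)^T =
    P - \sum_(1 <= k < n.+1) F k.
  have := @displacement_sum _ _ (Zmx R n.+1) (fun k => x k *m (x k)^T)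
    (fun k => y k *m (y k)^T) (fun k => F k + Q k) n.
  rewrite -/S => dispS.
  have splitB : T - S - Zmx R n.+1 *m (T - S) *m (Zmx R n.+1)^T =
      (T - Zmx R n.+1 *m T *m (Zmx R n.+1)^T) - (S - Zmx R n.+1 *m S *m (Zmx R n.+1)^T).
    rewrite mulmxBr mulmxBl; move: (_ *m S *m _) (_ *m T *m _) => a b.
    by apply/matrixP => i l; rewrite !mxE; ring.
  rewrite splitB disp dispS => [|k kn]; last by rewrite rec//= ?mulmxA ?addrA.
  rewrite /P trmx_mul !mulmxA big_split/=.
  move: (\sum_(_ <= _ < _) F _) (\sum_(_ <= _ < _) Q _) => f q.
  move: (u *m _) (v *m _) (x 1%N *m _) (y 1%N *m _) (y n.+1 *m _) (_ *m x _ *m _ *m _).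
  by move=> a b c d e g; apply/matrixP => i l; rewrite !mxE; ring.
have opP : opnorm P <= 2 * enorm u * (enorm (x 1%N - u) + enorm (y 1%N - v)) +
    (enorm (x 1%N - u) ^+ 2 + enorm (y 1%N - v) ^+ 2 +
            \sum_(1 <= k < n.+1) opnorm (Q k) +
            (enorm (y n.+1) ^+ 2 + enorm (Zmx R n.+1 *m x n.+1) ^+ 2)).
  have opx := opnorm_outer_diff u (x 1%N).
  have opy : opnorm (v *m v^T - y 1%N *m (y 1%N)^T) <=
      2 * enorm u * enorm (y 1%N - v) + enorm (y 1%N - v) ^+ 2.
    apply: le_trans (opnorm_outer_diff _ _) _.
    by rewrite lerD2r ler_wpM2r ?enorm_ge0// ler_wpM2l.
  apply: (@le_trans _ _ ((2 * enorm u * enorm (x 1%N - u) + enorm (x 1%N - u) ^+ 2) +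
      (2 * enorm u * enorm (y 1%N - v) + enorm (y 1%N - v) ^+ 2) +
      \sum_(1 <= k < n.+1) opnorm (Q k) +
      (enorm (y n.+1) ^+ 2 + enorm (Zmx R n.+1 *m x n.+1) ^+ 2))); last first.
    by rewrite le_eqVlt; apply/predU1P; left; ring.
  apply: le_trans (opnormB _ _) _; apply: lerD; last first.
    apply: le_trans (opnormB _ _) _; rewrite !expr2; apply: lerD; exact: opnorm_outer.
  apply: le_trans (opnormB _ _) _; apply: lerD; last exact: opnorm_sum.
  by apply: le_trans (opnormB _ _) _; apply: lerD.
apply: le_trans (opnorm_displacement dispS) _.
apply: (@le_trans _ _ (\sum_(j < n.+1) (opnorm P +
    \sum_(1 <= k < n.+1) opnorm (Zpow R n.+1 j *m F k *m (Zpow R n.+1 j)^T)))).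
  apply: ler_sum => j _; rewrite mulmxBr mulmxBl; apply: le_trans (opnormB _ _) _.
  rewrite lerD ?opnorm_Zpow_conj// mulmx_sumr mulmx_suml.
  exact: opnorm_sum.
rewrite big_split/= sumr_const card_ord -[opnorm P *+ _]mulr_natl [leRHS]addrAC lerD2r.
apply: le_trans (ler_wpM2l _ opP) _ => //.
by rewrite le_eqVlt; apply/predU1P; left; ring.
Qed.

Lemma gram_rows (R : realType) (n : nat) (x : nat -> 'cV[R]_n) :
  let U := \sum_(1 <= k < n.+1) e_ R n k *m (x k)^T in
  U^T *m U = \sum_(1 <= k < n.+1) x k *m (x k)^T.
Proof.
move=> U; have UE i l : U i l = x i.+1 l 0.
  rewrite /U summxE.
  under eq_bigr => k _.
    have -> : (e_ R n k *m (x k)^T) i l = if k == i.+1 then x k l 0 else 0.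
      rewrite mxE big_ord1 e_coord mxE eq_sym.
      by case: eqP => _; rewrite ?mul1r ?mul0r.
    over.
  by rewrite -big_mkcond big_nat1_eq; move: (ltn_ord i); rewrite -ltnS => ->.
apply/matrixP => i l; rewrite mxE summxE big_add1 big_mkord.
by apply: eq_bigr => k _; rewrite mxE !UE mxE big_ord1 mxE.
Qed.

(** * Rules for O estimates along a filter *)

Lemma eqO_le (R : realType) (T : Type) (F : filter_on T) (f g h : T -> R) :
  (\forall t \near F, `|f t| <= `|g t|) -> g =O_F h -> f =O_F h.
Proof.
move=> fg /eqO_exP[c c0 gh]; apply/eqO_exP; exists c => //.
by near=> t; apply: (@le_trans _ _ `|g t|); near: t.
Unshelve. all: by end_near. Qed.

Lemma eqO_sqr (R : realType) (T : Type) (F : filter_on T) (f h : T -> R) :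
  f =O_F h -> (fun t => f t ^+ 2) =O_F (fun t => h t ^+ 2).
Proof.
move=> /eqO_exP[c c0 fh]; apply/eqO_exP; exists (c ^+ 2); first by rewrite exprn_gt0.
near=> t; have ch0 : 0 <= c * `|h t| by rewrite mulr_ge0// ltW.
by rewrite !normrX -exprMn ler_pXn2r ?nnegrE//; near: t.
Unshelve. all: by end_near. Qed.

Lemma eqO_add (R : realType) (T : Type) (F : filter_on T) (f g h : T -> R) :
  f =O_F h -> g =O_F h -> (fun t => f t + g t) =O_F h.
Proof.
move=> /eqO_exP[a a0 fh] /eqO_exP[b b0 gh]; apply/eqO_exP.
exists (a + b); first exact: addr_gt0.
near=> t; apply: le_trans (ler_normD _ _) _; rewrite mulrDl lerD//.
  by near: t.
by near: t.
Unshelve. all: by end_near. Qed.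

Lemma eqO_scale (R : realType) (T : Type) (F : filter_on T) (a : R) (f h : T -> R) :
  f =O_F h -> (fun t => a * f t) =O_F h.
Proof.
move=> /eqO_exP[c c0 fh]; apply/eqO_exP; exists ((`|a| + 1) * c).
  by apply: mulr_gt0 => //; exact: ltr_wpDl.
near=> t; rewrite normrM -mulrA; apply: ler_pM => //; first by rewrite lerDl.
by near: t.
Unshelve. all: by end_near. Qed.

Lemma eqO_sum (R : realType) (T : Type) (F : filter_on T) (I : eqType) (r : seq I)
    (f : I -> T -> R) (h : T -> R) :
  (forall i, i \in r -> f i =O_F h) -> (fun t => \sum_(i <- r) f i t) =O_F h.
Proof.
elim: r => [|i r IH] fh.
  apply/eqO_exP; exists 1 => //; by near=> t; rewrite big_nil normr0 mulr_ge0.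
under eq_fun do rewrite big_cons.
apply: eqO_add; first by apply: fh; rewrite mem_head.
by apply: IH => k kr; apply: fh; rewrite inE kr orbT.
Unshelve. all: by end_near. Qed.

Lemma eqO_opnorm (R : realType) (T : Type) (F : filter_on T) (m n : nat)
    (A : T -> 'M[R]_(m, n)) (h : T -> R) :
  (forall i j, (fun t => A t i j) =O_F h) -> (fun t => opnorm (A t)) =O_F h.
Proof.
move=> Ah; apply: (@eqO_le _ _ _ _ (fun t => \sum_i \sum_j `|A t i j|)).
  near=> t; rewrite !ger0_norm ?opnorm_ge0 ?opnorm_le_entries//.
  by apply: sumr_ge0 => i _; apply: sumr_ge0.
apply: eqO_sum => i _; apply: eqO_sum => j _.
by apply: eqO_le (Ah i j); near=> t; rewrite normr_id.
Unshelve. all: by end_near. Qed.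

(** * Assembly of the first order error bound *)

Theorem theorem5p2 (R : realType) (n : nat) (n_gt0 : (0 < n)%N)
  (T : 'M[R]_n) (u v : 'cV[R]_n)
  (T_class : classT T) (T_gen : generators T u v)
  (u_ v_ : nat -> 'cV[R]_n) (theta : nat -> R)
  (exact_rec : downdating u v u_ v_ theta)
  (ut vt : R -> nat -> 'cV[R]_n)
  (ut_approx : forall k : nat, (1 <= k <= n)%N ->
     (fun eps : R => enorm (ut eps k - u_ k)) =O_ ((0 : R)^'+) (fun eps : R => eps))
  (vt_approx : forall k : nat, (1 <= k <= n)%N ->
     (fun eps : R => enorm (vt eps k - v_ k)) =O_ ((0 : R)^'+) (fun eps : R => eps))
  (G : R -> nat -> 'M[R]_n)
  (perturbed_rec : perturbed_downdating ut vt G)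
  (c_h : R) (c_h_gt0 : 0 < c_h)
  (G_bound : \forall eps \near (0 : R)^'+,
     forall k j : nat, (1 <= k < n)%N -> (j < n)%N ->
       opnorm (Zpow R n j *m G eps k *m (Zpow R n j)^T) <=
         c_h * opnorm (Hrot (theta k)) *
         (enorm (Zpow R n j.+1 *m u_ k) + enorm (Zpow R n j *m v_ k)) *
         (enorm (Zpow R n j *m u_ k.+1) + enorm (Zpow R n j *m v_ k.+1))) :
  let Ut (eps : R) : 'M[R]_n :=
    \sum_(1 <= k < n.+1) e_ R n k *m (ut eps k)^T in
  exists2 r : R -> R,
    r =O_ ((0 : R)^'+) (fun eps : R => eps ^+ 2) &
    \forall eps \near (0 : R)^'+,
      opnorm (T - (Ut eps)^T *m Ut eps) <=
        2 * n%:R * enorm u * (enorm (ut eps 1%N - u) + enorm (vt eps 1%N - v))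
        + 8 * eps * c_h *
          (\sum_(1 <= j < n)
             (n - j)%:R * \tr (Zpow R n j *m T *m (Zpow R n j)^T))
        + r eps.
Proof.
move=> Ut; case: T_class => T_pos _.
have [TE Zun vn rec] := downdating_exact n_gt0 T_pos T_gen exact_rec.
have [u1E v1E _] := exact_rec.
have vu : enorm v <= enorm u.
  have := @downdating_v_le_u _ _ _ _ _ 0 1%N rec vn.
  by rewrite n_gt0 Zpow0 !mul1mx u1E v1E; apply.
pose Q eps k := ut eps k.+1 *m (ut eps k.+1)^T - vt eps k.+1 *m (vt eps k.+1)^T
  - (Zmx R n *m ut eps k *m (ut eps k)^T *m (Zmx R n)^T
     - vt eps k *m (vt eps k)^T + eps *: G eps k).
(* The remainder is exactly the last summand of [perturbation_bound], so only its order remains to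
   be checked. *)
pose r eps := n%:R * (enorm (ut eps 1%N - u) ^+ 2 + enorm (vt eps 1%N - v) ^+ 2 +
  \sum_(1 <= k < n) opnorm (Q eps k) +
  (enorm (vt eps n) ^+ 2 + enorm (Zmx R n *m ut eps n) ^+ 2)).
have n0n : (1 <= n <= n)%N by rewrite n_gt0 leqnn.
exists r.
  apply: eqO_scale; apply: eqO_add; first apply: eqO_add; first apply: eqO_add.
  - by apply: eqO_sqr; rewrite -u1E; apply: ut_approx.
  - by apply: eqO_sqr; rewrite -v1E; apply: vt_approx.
  - apply: eqO_sum => k; rewrite mem_index_iota => kn; apply: eqO_opnorm => a b.
    have [c c0 Qc] := (eqO_exP _ _ _).1 (perturbed_rec k kn a b).
    (* The case [j = 0] of [G_bound] bounds [opnorm (G eps k)] by [c_h * g], independent of [eps],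
       so the residual is a true [O(eps^2)]. The added 1 below keeps the constant positive even if
       [g = 0]. *)
    set g := opnorm (Hrot (theta k)) *
      (enorm (Zpow R n 1 *m u_ k) + enorm (Zpow R n 0 *m v_ k)) *
      (enorm (Zpow R n 0 *m u_ k.+1) + enorm (Zpow R n 0 *m v_ k.+1)).
    have g0 : 0 <= c_h * g.
      rewrite /g -?mulrA !mulr_ge0 ?addr_ge0 ?opnorm_ge0 ?enorm_ge0//; exact: ltW.
    apply/eqO_exP; exists (c * (c_h * g + 1)).
      by rewrite mulr_gt0// ltr_wpDl.
    have Gg : \forall eps \near (0 : R)^'+, opnorm (G eps k) <= c_h * g.
      apply: filterS G_bound => eps /(_ k 0%N kn n_gt0).
      by rewrite {1 2}Zpow0 mul1mx trmx1 mulmx1 /g !mulrA.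
    near=> eps; apply: (@le_trans _ _ (c * `|eps ^+ 2 * opnorm (G eps k)|)).
      by near: eps.
    rewrite normrM -mulrA; apply: ler_wpM2l; first exact: ltW.
    rewrite mulrC ler_wpM2r// ger0_norm ?opnorm_ge0//.
    apply: (@le_trans _ _ (c_h * g)); last by rewrite lerDl.
    by near: eps.
  (* Both boundary terms are squares of [O(eps)] quantities, since [v_ n] and [Zmx R n *m u_ n] are
     zero. *)
  apply: eqO_add; first by have := eqO_sqr (vt_approx n n0n); under eq_fun do rewrite vn subr0.
  apply: eqO_le (eqO_sqr (ut_approx n n0n)); near=> eps.
  rewrite !ger0_norm ?sqr_ge0// ler_sqr_enorm.
  have -> : Zmx R n *m ut eps n = Zmx R n *m (ut eps n - u_ n).
    by rewrite mulmxBr Zun subr0.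
  exact: enorm_Zmx_le.
near=> eps.
have eps0 : 0 < eps by near: eps; exact: nbhs_right_gt.
have Gb : forall k j : nat, (1 <= k < n)%N -> (j < n)%N ->
       opnorm (Zpow R n j *m G eps k *m (Zpow R n j)^T) <=
         c_h * opnorm (Hrot (theta k)) *
         (enorm (Zpow R n j.+1 *m u_ k) + enorm (Zpow R n j *m v_ k)) *
         (enorm (Zpow R n j *m u_ k.+1) + enorm (Zpow R n j *m v_ k.+1)).
  by near: eps.
rewrite gram_rows.
have Qrec k : (0 < k < n)%N ->
    ut eps k.+1 *m (ut eps k.+1)^T - vt eps k.+1 *m (vt eps k.+1)^T =
    Zmx R n *m ut eps k *m (ut eps k)^T *m (Zmx R n)^T - vt eps k *m (vt eps k)^T +
    eps *: G eps k + Q eps k.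
  by move=> _; rewrite /Q [RHS]addrC subrK.
apply: le_trans (perturbation_bound n_gt0 T_gen vu Qrec) _.
rewrite -/(r eps) lerD2r lerD2l.
have := sum_downdating_growth n_gt0 TE rec vn.
set W := \sum_(1 <= _ < _) _ => growth.
have -> : 8 * eps * c_h * W = eps * c_h * (8 * W) by ring.
apply: le_trans (ler_wpM2l _ growth); last by rewrite mulr_ge0// ltW.
rewrite mulr_sumr; apply: ler_sum => j _; rewrite mulr_sumr ler_sum_nat// => k kn.
rewrite -scalemxAr -scalemxAl; apply: le_trans (opnormZ_le _ _) _.
rewrite gtr0_norm// -[leRHS]mulrA; apply: ler_wpM2l; first exact: ltW.
by rewrite !mulrA; apply: Gb.
Unshelve. all: by end_near. Qed.
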